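(* For $n\ge0$ and $i=1,2$, $$C_n^i(x,t,s,h\,|\,\alpha,p,q)=\sum_{k=0}^{\lfloor n/2\rfloor}\gamma^i_{n,k}(t)\,x^k(1+x)^{n-2k},$$ where $$\gamma^1_{n,k}(t)=\sum_{\sigma\in\mathfrak{S}_{n,\mathrm{exc}=k}^{\mathrm{cda}=0}}t^{\mathrm{fix}(\sigma)}s^{\mathrm{inv}(\sigma)}h^{\mathrm{depth}(\sigma)}\alpha^{\mathrm{lmax}(\sigma)+\mathrm{rmin}(\sigma)}p^{\mathrm{cros}(\sigma)}q^{\mathrm{nest}(\sigma)},$$ $$\gamma^2_{n,k}(t)=\sum_{\sigma\in\mathfrak{S}_{n,\mathrm{exc}=k}^{\mathrm{cda}=0}}t^{\mathrm{fix}(\sigma)}s^{\mathrm{inv}(\sigma)}h^{\mathrm{depth}(\sigma)}\alpha^{\mathrm{lmax}(\sigma)+\mathrm{rmin}(\sigma)}p^{\mathrm{cros}(\sigma)+\mathrm{drop}(\sigma)}q^{\mathrm{nest}(\sigma)}.$$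
   Context: For $\sigma\in\mathfrak{S}_n$ (permutations of $[n]$, $\sigma_i=\sigma(i)$): $\mathrm{exc}(\sigma)=\#\{i:\sigma(i)>i\}$, $\mathrm{drop}(\sigma)=\#\{i:\sigma(i)<i\}$, $\mathrm{fix}(\sigma)=\#\{i:\sigma(i)=i\}$, $\mathrm{cda}(\sigma)=\#\{i:\sigma^{-1}(i)<i<\sigma(i)\}$, $\mathrm{inv}(\sigma)=\#\{i<j:\sigma_i>\sigma_j\}$, $\mathrm{depth}(\sigma)=\sum_{\sigma(i)>i}(\sigma(i)-i)$; $\mathrm{lmax}(\sigma)$ is the number of letters larger than all letters to their left, $\mathrm{rmin}(\sigma)$ the number of letters smaller than all letters to their right; $$\mathrm{cros}(\sigma)=\#\{(i,j)\in[n]^2:(i<j\le\sigma_i<\sigma_j)\lor(i>j>\sigma_i>\sigma_j)\},$$ $$\mathrm{nest}(\sigma)=\#\{(i,j)\in[n]^2:(i<j\le\sigma_j<\sigma_i)\lor(i>j>\sigma_j>\sigma_i)\}.$$ Let $\mathrm{w}^c(\sigma)=x^{\mathrm{exc}(\sigma)}\bigl(t(1+x)\bigr)^{\mathrm{fix}(\sigma)}s^{\mathrm{inv}(\sigma)}h^{\mathrm{depth}(\sigma)}\alpha^{\mathrm{rmin}(\sigma)+\mathrm{lmax}(\sigma)}$ and define $$C_n^1(x,t,s,h\,|\,\alpha,p,q)=\sum_{\sigma\in\mathfrak{S}_n}\mathrm{w}^c(\sigma)\,p^{\mathrm{cros}(\sigma)-\mathrm{cda}(\sigma)}q^{\mathrm{nest}(\sigma)},\qquad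 C_n^2(x,t,s,h\,|\,\alpha,p,q)=\sum_{\sigma\in\mathfrak{S}_n}\mathrm{w}^c(\sigma)\,p^{\mathrm{cros}(\sigma)+\mathrm{drop}(\sigma)}q^{\mathrm{nest}(\sigma)}.$$ $\mathfrak{S}_{n,\mathrm{exc}=k}^{\mathrm{cda}=0}=\{\sigma\in\mathfrak{S}_n:\mathrm{cda}(\sigma)=0,\ \mathrm{exc}(\sigma)=k\}$. For $n=0$, $\mathfrak S_0$ consists of the empty permutation, of weight $1$. *)

(* Defs.v *)
From mathcomp Require Import all_boot all_fingroup all_algebra.

Set Implicit Arguments.
Unset Strict Implicit.
Unset Printing Implicit Defensive.

Import GRing.Theory.

(* [n] = {1, .., n} is represented by 'I_n = {0, .., n-1}: every statistic below
   depends only on comparisons and differences of positions and letters, hence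
   is unchanged by this shift. *)

Section Statistics.
Variable n : nat.
Implicit Type sigma : 'S_n.

Definition exc sigma : nat := #|[set i : 'I_n | i < sigma i]|.

Definition drop sigma : nat := #|[set i : 'I_n | sigma i < i]|.

Definition fixp sigma : nat := #|[set i : 'I_n | sigma i == i]|.

Definition cda sigma : nat := #|[set i : 'I_n | (sigma^-1)%g i < i < sigma i]|.

Definition inv sigma : nat :=
  #|[set ij : 'I_n * 'I_n | (ij.1 < ij.2) && (sigma ij.2 < sigma ij.1)]|.

Definition depth sigma : nat := \sum_(i < n | i < sigma i) (sigma i - i).

Definition lmax sigma : nat :=
  #|[set i : 'I_n | [forall j : 'I_n, (j < i) ==> (sigma j < sigma i)]]|.

Definition rmin sigma : nat :=
  #|[set i : 'I_n | [forall j : 'I_n, (i < j) ==> (sigma i < sigma j)]]|.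

Definition cros sigma : nat :=
  #|[set ij : 'I_n * 'I_n |
      let: (i, j) := ij in
      [&& i < j, j <= sigma i & sigma i < sigma j]
      || [&& j < i, sigma i < j & sigma j < sigma i]]|.

Definition nest sigma : nat :=
  #|[set ij : 'I_n * 'I_n |
      let: (i, j) := ij in
      [&& i < j, j <= sigma j & sigma j < sigma i]
      || [&& j < i, sigma j < j & sigma i < sigma j]]|.

(* Hence the exponent [cros sigma - cda sigma] below is never truncated. *)
Lemma leq_cda_cros sigma : cda sigma <= cros sigma.
Proof.
pose f (j : 'I_n) := ((sigma^-1)%g j, j).
have f_inj : injective f by move=> i j [].
rewrite /cda -(card_imset _ f_inj); apply/subset_leq_card/subsetP => ij.
case/imsetP=> j; rewrite inE => /andP[lt_ij lt_js] ->.
by rewrite inE /= permKV lt_ij leqnn lt_js.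
Qed.

End Statistics.

Local Open Scope ring_scope.

(* Polynomial identities in x, t, s, h, alpha, p, q are read as identities
   between elements of an arbitrary commutative ring. *)
Section Polynomials.
Variable R : comNzRingType.
Implicit Types x t s h alpha p q : R.

Definition wc n x t s h alpha (sigma : 'S_n) : R :=
  x ^+ exc sigma * (t * (1 + x)) ^+ fixp sigma * s ^+ inv sigma
  * h ^+ depth sigma * alpha ^+ (rmin sigma + lmax sigma).

Definition C1 n x t s h alpha p q : R :=
  \sum_(sigma : 'S_n)
    wc x t s h alpha sigma * p ^+ (cros sigma - cda sigma) * q ^+ nest sigma.

Definition C2 n x t s h alpha p q : R :=
  \sum_(sigma : 'S_n)
    wc x t s h alpha sigma * p ^+ (cros sigma + drop sigma) * q ^+ nest sigma.

Definition gamma1 n k t s h alpha p q : R :=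
  \sum_(sigma : 'S_n | (cda sigma == 0)%N && (exc sigma == k))
    t ^+ fixp sigma * s ^+ inv sigma * h ^+ depth sigma
    * alpha ^+ (lmax sigma + rmin sigma) * p ^+ cros sigma * q ^+ nest sigma.

Definition gamma2 n k t s h alpha p q : R :=
  \sum_(sigma : 'S_n | (cda sigma == 0)%N && (exc sigma == k))
    t ^+ fixp sigma * s ^+ inv sigma * h ^+ depth sigma
    * alpha ^+ (lmax sigma + rmin sigma) * p ^+ (cros sigma + drop sigma)
    * q ^+ nest sigma.

End Polynomials.

(* Main.v *)
Require Import Defs.
From mathcomp Require Import all_boot all_fingroup all_algebra.
From mathcomp Require Import zify ring.

Set Implicit Arguments.
Unset Strict Implicit.
Unset Printing Implicit Defensive.

Import GRing.Theory.

(** Draw each value [s i] as an arc from [i]: an upper arc if [i < s i], a lower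
    arc if [s i < i], a loop if [s i = i].  Reading the vertices from left to
    right, a vertex either opens an upper and a lower arc (cycle valley), closes
    one of each (cycle peak), closes and opens an upper arc (cycle double
    ascent, counted by [cda]), does the same with lower arcs (cycle double
    descent, counted by [cdd]), or carries a loop.  As many upper as lower arcs
    are open before any vertex; this common number is its level.  Writing down,
    for each vertex, its type and the rank of each arc that it closes among the
    open ones is the Foata-Zeilberger encoding of permutations by weighted
    Motzkin paths.

    The statistics of the theorem are sums over the vertices of functions of
    the level and the letter written there: [nest_sum], [cros_sum], [inv_sum],
    [depth_level], [lmax_sum], [rmin_lmaxV].  With [cros] replaced by
    [cros - cda], and [drop] by [cda + drop], the contribution of a cycle double
    ascent that closes the arc of rank [r] at level [k] is that of a cycle
    double descent with the same [r] and [k].  Both keep the level, so one can be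
    exchanged for the other in a code without touching the rest.  Therefore
    the sum of [a ^+ cda * b ^+ cdd * (the other statistics)] depends only on
    [a + b] ([sum_toggle]).  The theorem is the comparison of [a = x, b = 1] with
    [a = 0, b = 1 + x] ([sum_cda0]): the first choice gives the power
    [x ^+ exc], the second one kills the permutations with [cda s > 0] and gives
    the others the factor [x ^+ exc * (1 + x) ^+ (n - 2 * exc)]. The two halves
    of the theorem differ by the weight [d] of [cda + drop], which is [1] in the
    first and [p] in the second.

    The encoding is injective ([code_inj]), and its image is the whole set of
    codes because there are exactly [n`!] of these: more generally there are
    [m ^_ k * m`!] ways to complete a code from level [k] in [m] steps
    ([size_codes]).  No inverse of the encoding has to be described. *)

(** * Counting by sums of booleans *)

Lemma card_set_sum (T : finType) (P : pred T) : #|[set i | P i]| = \sum_i P i.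
Proof. by rewrite -sum1dep_card big_mkcond; apply: eq_bigr => i _; case: (P i). Qed.

Lemma card_set_pair_sum (T : finType) (P : rel T) :
  #|[set ij : T * T | P ij.1 ij.2]| = \sum_i \sum_j P i j.
Proof. by rewrite card_set_sum pair_bigA. Qed.

Lemma sum_pred1 (T : finType) (v : T) (P : pred T) :
  \sum_j ((j == v) && P j) = P v.
Proof.
by rewrite (bigD1 v) //= eqxx big1 ?addn0 // => j /negPf ->.
Qed.

(** * Levels, ranks and letters *)

(** The first component is the rank of the upper arc closed at a vertex, the
    second one the rank of the lower arc; [None] means that none is closed. *)
Notation vletter := (option nat * option nat)%type.

Section Histories.
Variable n : nat.
Implicit Types (s u : 'S_n) (v i j : 'I_n).

Definition level s (m : nat) : nat := \sum_(j : 'I_n) (j < m <= s j).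

(** If an upper arc ends at [v], this is its rank among the upper arcs open just
    before [v], in the order of their left ends; it is also the number of upper
    arcs that cover it.  The lower arc whose right end is [v] has rank
    [uprank s^-1 v], because inversion exchanges upper and lower arcs. *)
Definition uprank s v : nat := \sum_(j : 'I_n) ((j < (s^-1)%g v) && (v < s j)).

Definition upcross s v : nat := \sum_(j : 'I_n) (((s^-1)%g v < j < v) && (v < s j)).

(** A loop counts as an upper arc.  All open upper arcs cover it, so it has rank
    [level s v], while a proper arc has a smaller rank: letters
    [(Some r, None)] at level [k] are cycle double ascents if [r < k] and loops
    if [r = k]. *)
Definition letter s v : vletter :=
  (if (s^-1)%g v <= v then Some (uprank s v) else None,
   if s v < v then Some (uprank s^-1 v) else None).

Lemma perm_eqV s j v : (s j == v :> nat) = (j == (s^-1)%g v :> nat).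
Proof. by rewrite -[LHS]/(s j == v) -[RHS]/(j == _) (canF_eq (permK s)). Qed.

Lemma reindex_perm s (F : 'I_n -> nat) : \sum_i F (s i) = \sum_i F i.
Proof. by rewrite [RHS](reindex_inj (@perm_inj _ s)). Qed.

(** Among the [m] first positions and the [m] first values, those matched with
    each other are equally many, hence so are those left open. *)
Lemma levelV s m : level s^-1 m = level s m.
Proof.
rewrite /level -(reindex_perm s).
apply: (@addIn (\sum_(j : 'I_n) ((j < m) && (s j < m)))); rewrite -!big_split /=.
under eq_bigr => j _ do rewrite permK.
transitivity (\sum_j (s j < m)); first by apply: eq_bigr => j _; lia.
rewrite (reindex_perm s (fun i => (i < m) : nat)).
by apply: eq_bigr => j _; lia.
Qed.

Lemma level0 s : level s 0 = 0.
Proof. by apply: big1. Qed.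

Lemma leveln s : level s n = 0.
Proof. by apply: big1 => j _; have := ltn_ord (s j); lia. Qed.

Lemma levelS s v :
  level s v.+1 + ((s^-1)%g v < v) = level s v + (v < s v).
Proof.
rewrite -(sum_pred1 v (fun j => v < s j)).
rewrite -(sum_pred1 ((s^-1)%g v) (fun j => j < v)) -!big_split /=.
apply: eq_bigr => j _; rewrite -!val_eqE /=.
have := perm_eqV s j v; lia.
Qed.

(** Just before an upper arc closes at [v], the open arcs are this one, those
    that cover it and those that cross it. *)
Lemma level_closer s v :
  (s^-1)%g v < v -> level s v = (uprank s v + upcross s v).+1.
Proof.
move=> lt_v; rewrite -addn1 -[X in _ + X]/(nat_of_bool true).
rewrite -(sum_pred1 ((s^-1)%g v) xpredT) -!big_split /=.
apply: eq_bigr => j _; rewrite -!val_eqE /= andbT.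
have := perm_eqV s j v; lia.
Qed.

Lemma level_fix s v : s v = v -> uprank s v = level s v.
Proof.
move=> sv; have sVv : (s^-1)%g v = v by rewrite -[in LHS]sv permK.
apply: eq_bigr => j _; have := perm_eqV s j v; rewrite sVv; lia.
Qed.

Lemma uprankV s v : uprank s^-1 v = \sum_(j : 'I_n) ((s j < s v) && (v < j)).
Proof.
rewrite /uprank invgK -(reindex_perm s).
by under eq_bigr => j _ do rewrite permK.
Qed.

(** Two permutations for which the same upper arcs are open at [v] and which
    close there arcs of equal rank close the same one. *)
Lemma uprank_inj s u v :
    (s^-1)%g v <= v -> (u^-1)%g v <= v ->
    (forall i, i < v -> (s i < v) = (u i < v)) ->
  uprank s v = uprank u v -> (s^-1)%g v = (u^-1)%g v.
Proof.
wlog lt_ab : s u / (s^-1)%g v < (u^-1)%g v.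
  move=> W sv uv agree eq_r.
  case: (ltngtP ((s^-1)%g v) ((u^-1)%g v)) => [lt|gt|/val_inj//].
  - exact: W.
  - by apply/esym/W => // i /agree.
move=> sv uv agree.
suff: uprank s v < uprank u v by lia.
rewrite -addn1 -[X in _ + X]/(nat_of_bool true).
rewrite -(sum_pred1 ((s^-1)%g v) xpredT) -!big_split /=.
apply: leq_sum => j _; rewrite -!val_eqE /= andbT.
have := perm_eqV s j v; have := perm_eqV u j v; have := agree j.
by lia.
Qed.

(** By induction on the vertices: equal letters to the left of [v] mean equal
    arcs with both ends to the left of [v], hence the same open arcs at [v], and
    the letter of [v] tells which of them are closed there. *)
Lemma letter_inj s u : letter s =1 letter u -> s = u.
Proof.
move=> eq_su.
have up v : ((s^-1)%g v <= v) = ((u^-1)%g v <= v) /\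
     ((s^-1)%g v <= v -> uprank s v = uprank u v).
  by have /(congr1 fst) /= := eq_su v; do 2?case: leqP => // _; case.
have low v : (s v < v) = (u v < v) /\
     (s v < v -> uprank s^-1 v = uprank u^-1 v).
  by have /(congr1 snd) /= := eq_su v; do 2?case: ltnP => // _; case.
have main m : forall v, v < m -> ((s^-1)%g v <= v -> (s^-1)%g v = (u^-1)%g v)
   /\ (s v < v -> s v = u v).
  elim: m => // m IH v; rewrite ltnS => le_vm.
  (* the same arcs are open at [v], on both sides *)
  have agree i : i < v -> ((s i < v) = (u i < v)) /\ (((s^-1)%g i < v) = ((u^-1)%g i < v)).
    move=> lt_iv; split; apply/idP/idP => lt_v.
    - case: (ltnP (s i) i) => [lt_i|le_i]; first by rewrite -(IH i _).2 //; lia.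
      have [|+ _] := IH (s i); first lia.
      by rewrite permK => /(_ le_i) {1}->; rewrite permKV.
    - case: (ltnP (u i) i) => [|le_i]; first by rewrite -(low i).1; lia.
      have [|+ _] := IH (u i); first lia.
      by rewrite (up _).1 permK => /(_ le_i) <-; rewrite permKV.
    - case: (leqP ((s^-1)%g i) i) => [le_i|lt_i]; first by rewrite -(IH i _).1 //; lia.
      have [|_] := IH ((s^-1)%g i); first lia.
      by rewrite permKV => /(_ lt_i) {1}->; rewrite permK.
    - case: (leqP ((u^-1)%g i) i) => [|lt_i]; first by rewrite -(up i).1; lia.
      have [|_] := IH ((u^-1)%g i); first lia.
      by rewrite (low _).1 permKV => /(_ lt_i) <-; rewrite permK.
  split=> [a_le|lt_sv].
    apply: uprank_inj => //.
    - by rewrite -(up v).1.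
    - by move=> i /agree[].
    - exact: (up v).2.
  rewrite -[s]invgK -[u]invgK; apply: uprank_inj; rewrite ?invgK.
  - exact: ltnW.
  - by apply: ltnW; rewrite -(low v).1.
  - by move=> i /agree[].
  - exact: (low v).2.
apply/permP=> v; case: (ltnP (s v) v) => [|le_v].
  exact: (main v.+1 v _).2.
have := (main (s v).+1 (s v) (ltnSn _)).1; rewrite permK => /(_ le_v) {2}->.
by rewrite permKV.
Qed.

(** * Codes, and why every code comes from a permutation *)

Definition level_after (k : nat) (l : vletter) : nat :=
  match l with
  | (None, None) => k.+1
  | (Some _, Some _) => k.-1
  | _ => k
  end.

Definition letters (k : nat) : seq vletter :=
  (None, None)
    :: [seq (Some r, None) | r <- iota 0 k.+1]
    ++ [seq (None, Some r) | r <- iota 0 k]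
    ++ [seq (Some r, Some r') | r <- iota 0 k, r' <- iota 0 k].

(** These are the weighted Motzkin paths from level [k] to level 0 in [m] steps. *)
Fixpoint codes (m k : nat) : seq (seq vletter) :=
  if m is m'.+1 then [seq l :: c | l <- letters k, c <- codes m' (level_after k l)]
  else if k is 0 then [:: [::]] else [::].

Lemma codesS m k :
  codes m.+1 k = [seq l :: c | l <- letters k, c <- codes m (level_after k l)].
Proof. by []. Qed.

(** The count behind the closed form: what remains is to match [k] open arcs on
    each side and [m] new vertices, by a bijection between [k + m] positions and
    [k + m] values that sends no open position to an open value.  There are
    [m ^_ k] ways to place the open positions, and then [m`!] for the rest. *)
Lemma size_codes m k : size (codes m k) = m ^_ k * m`!.
Proof.
elim: m k => [|m IH] k; first by case: k.
rewrite -sum1_size codesS big_allpairs_dep.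
under eq_bigr => l _ do rewrite sum1_size IH.
rewrite big_cons !big_cat !big_map big_allpairs_dep /=.
rewrite !big_const_seq !count_predT !size_iota !iter_addn !addn0.
rewrite /= size_iota; case: k => [|k].
  by rewrite !ffactn0 ffactn1 factS /=; lia.
rewrite factS ffactSS [m ^_ k.+2]ffactnSr ffactnSr /=.
case: (leqP k m) => [le_km|lt_mk]; last by rewrite ffact_small //; lia.
move: (m ^_ k) (m`!) => a b.
have [d ->] : exists d, m = k + d by exists (m - k); lia.
rewrite addKn; case: d => [|d]; first by lia.
have -> : k + d.+1 - k.+1 = d by lia.
by lia.
Qed.

Lemma mem_letter s v : letter s v \in letters (level s v).
Proof.
rewrite /letter /letters.
have up := @level_closer s v; have low := @level_closer s^-1 v.
rewrite levelV invgK in low.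
have fixE := @level_fix s v; have eq_v := perm_eqV s v v.
case: (leqP ((s^-1)%g v)) => [le_v|lt_v];
  case: (ltnP (s v)) => [lt_sv|le_sv]; rewrite in_cons !mem_cat.
- apply/or4P/Or44/allpairsP.
  by exists (uprank s v, uprank s^-1 v); split=> //; rewrite mem_iota /=; lia.
- apply/or4P/Or42/(map_f (fun r => (Some r, None))); rewrite mem_iota.
  case: (ltngtP ((s^-1)%g v) v) le_v => // [/up|eq_sv]; first by lia.
  by move: eq_v; rewrite eq_sv eqxx => /eqP/val_inj/fixE; lia.
- by apply/or4P/Or43/(map_f (fun r => (None, Some r))); rewrite mem_iota; lia.
- by rewrite eqxx.
Qed.

Lemma level_after_letter s v : level_after (level s v) (letter s v) = level s v.+1.
Proof.
have step := levelS s v; have eq_v := perm_eqV s v v.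
have up := @level_closer s v.
by rewrite /letter; case: (leqP ((s^-1)%g v)) => [le_v|lt_v];
  case: (ltnP (s v)) => [lt_sv|le_sv] //=; lia.
Qed.

(** Ends of codes: [codes] adds letters on the left, so the induction that compares
    it with permutations goes down from the last vertex. *)
Definition suffix s m := [seq letter s v | v <- drop m (enum 'I_n)].

Lemma suffix_ord s v : suffix s v = letter s v :: suffix s v.+1.
Proof. by rewrite /suffix (drop_nth v) ?size_enum_ord //= nth_ord_enum. Qed.

Lemma ex_ord m : m < n -> exists v, m = v.
Proof. by move=> lt_mn; exists (Ordinal lt_mn). Qed.

Lemma mem_suffix s d : d <= n -> suffix s (n - d) \in codes d (level s (n - d)).
Proof.
elim: d => [|d IH] le_dn.
  by rewrite subn0 /suffix drop_oversize ?size_enum_ord // leveln.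
have [|v def_v] := @ex_ord (n - d.+1); first lia.
have def_v1 : n - d = v.+1 by lia.
move: IH; rewrite def_v def_v1 suffix_ord => IH.
apply/allpairsPdep; exists (letter s v), (suffix s v.+1).
by rewrite mem_letter level_after_letter IH //; lia.
Qed.

Definition code s := [seq letter s v | v <- enum 'I_n].

Lemma code_inj : injective code.
Proof.
move=> s u /eq_in_map eq_su; apply: letter_inj => v.
by apply: eq_su; rewrite mem_enum.
Qed.

(** Injectivity and the equality of the cardinals, both [n`!], give surjectivity. *)
Lemma perm_codes : perm_eq [seq code s | s <- enum 'S_n] (codes n 0).
Proof.
have uniq_code : uniq [seq code s | s <- enum 'S_n].
  by rewrite map_inj_uniq ?enum_uniq //; exact: code_inj.
have sub_code : {subset [seq code s | s <- enum 'S_n] <= codes n 0}.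
  move=> _ /mapP[s _ ->]; have := mem_suffix s (leqnn n).
  by rewrite subnn level0 /suffix drop0.
have le_size : size (codes n 0) <= size [seq code s | s <- enum 'S_n].
  by rewrite size_map -cardE card_Sn size_codes ffactn0 mul1n.
have [_ eq_mem] := uniq_min_size uniq_code sub_code le_size.
apply: uniq_perm => //; exact: leq_size_uniq le_size.
Qed.

(** * Statistics as sums over the vertices *)

Lemma sum_ltn m : m <= n -> \sum_(v : 'I_n) (v < m) = m.
Proof.
move=> le_mn; transitivity (\sum_(v < n | v < m) 1).
  by rewrite [RHS]big_mkcond; apply: eq_bigr => v _; case: ifP.
by rewrite -(big_ord_widen n (fun=> 1) le_mn) sum1_card card_ord.
Qed.

(** An upper arc of length [l] is open at [l] vertices. *)
Lemma depth_level s : depth s = \sum_(v : 'I_n) level s v.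
Proof.
rewrite exchange_big /= /depth big_mkcond /=; apply: eq_bigr => j _.
have lt_sj := ltn_ord (s j).
case: ltnP => [lt_j|le_j]; last by rewrite big1 // => v _; lia.
apply: (@addIn (\sum_(v : 'I_n) (v < j.+1))); rewrite -big_split /=.
transitivity (\sum_(v : 'I_n) (v < (s j).+1)); first by rewrite !sum_ltn //; lia.
by apply: eq_bigr => v _; lia.
Qed.

Definition cdd s : nat := #|[set i : 'I_n | s i < i < (s^-1)%g i]|.
Definition cpeak s : nat := #|[set i : 'I_n | ((s^-1)%g i < i) && (s i < i)]|.

Lemma exc_sum s : exc s = \sum_(v : 'I_n) ((s^-1)%g v < v).
Proof.
rewrite /exc card_set_sum -[RHS](reindex_perm s).
by apply: eq_bigr => v _; rewrite permK.
Qed.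

Lemma excE s : exc s = cpeak s + cda s.
Proof.
rewrite exc_sum /cpeak /cda !card_set_sum -big_split /=.
by apply: eq_bigr => v _; have := perm_eqV s v v; lia.
Qed.

Lemma dropE s : Defs.drop s = cpeak s + cdd s.
Proof.
rewrite /Defs.drop /cpeak /cdd !card_set_sum -big_split /=.
by apply: eq_bigr => v _; have := perm_eqV s v v; lia.
Qed.

Lemma exc_fix_drop s : exc s + fixp s + Defs.drop s = n.
Proof.
rewrite /exc /Defs.drop /fixp !card_set_sum -!big_split /=.
rewrite -[RHS]card_ord -sum1_card.
by apply: eq_bigr => v _; rewrite -val_eqE /=; lia.
Qed.

Lemma sum_upnest s :
  \sum_(v : 'I_n) ((s^-1)%g v <= v) * uprank s v
    = \sum_(i : 'I_n) \sum_(j : 'I_n) [&& i < j, j <= s j & s j < s i].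
Proof.
rewrite -(reindex_perm s) exchange_big /=; apply: eq_bigr => j _.
rewrite permK big_distrr /=; apply: eq_bigr => i _.
by rewrite permK; lia.
Qed.

Lemma sum_lownest s :
  \sum_(v : 'I_n) (s v < v) * uprank s^-1 v
    = \sum_(i : 'I_n) \sum_(j : 'I_n) [&& j < i, s j < j & s i < s j].
Proof.
rewrite exchange_big /=; apply: eq_bigr => j _.
by rewrite uprankV big_distrr /=; apply: eq_bigr => i _; lia.
Qed.

Lemma nest_sum s :
  nest s = \sum_(v : 'I_n) (((s^-1)%g v <= v) * uprank s v + (s v < v) * uprank s^-1 v).
Proof.
rewrite big_split /= sum_upnest sum_lownest -big_split /=.
rewrite /nest (eq_card (B := [set ij : 'I_n * 'I_n |
   [&& ij.1 < ij.2, ij.2 <= s ij.2 & s ij.2 < s ij.1] ||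
   [&& ij.2 < ij.1, s ij.2 < ij.2 & s ij.1 < s ij.2]])); last first.
  by case=> i j; rewrite !inE.
rewrite (card_set_pair_sum (fun i j : 'I_n => [&& i < j, j <= s j & s j < s i] ||
   [&& j < i, s j < j & s i < s j])).
by apply: eq_bigr => i _; rewrite -big_split; apply: eq_bigr => j _ /=; lia.
Qed.

Lemma upcrossV s v :
  upcross s^-1 v = \sum_(i : 'I_n) ((s v < s i < v) && (v < i)).
Proof.
rewrite /upcross invgK -(reindex_perm s).
by under eq_bigr => j _ do rewrite permK.
Qed.

(** Upper crossings allow [j = s i], that is two consecutive arcs meeting at a
    cycle double ascent, which lower crossings do not: hence the term [cda]. *)
Lemma cros_sum s :
  cros s = \sum_(v : 'I_n) (((s^-1)%g v < v) * upcross s v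
              + (s v < v) * upcross s^-1 v) + cda s.
Proof.
rewrite /cros (eq_card (B := [set ij : 'I_n * 'I_n |
   [&& ij.1 < ij.2, ij.2 <= s ij.1 & s ij.1 < s ij.2] ||
   [&& ij.2 < ij.1, s ij.1 < ij.2 & s ij.2 < s ij.1]])); last first.
  by case=> i j; rewrite !inE.
rewrite (card_set_pair_sum (fun i j : 'I_n => [&& i < j, j <= s i & s i < s j] ||
   [&& j < i, s i < j & s j < s i])).
have -> : cda s = \sum_(i : 'I_n) \sum_(j : 'I_n) ((j == s i) && (i < j < s j)).
  rewrite /cda card_set_sum -(reindex_perm s); apply: eq_bigr => i _.
  by rewrite (sum_pred1 _ (fun j => i < j < s j)) permK.
have -> : \sum_(v : 'I_n) (((s^-1)%g v < v) * upcross s v + (s v < v) * upcross s^-1 v)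
  = \sum_(i : 'I_n) \sum_(j : 'I_n)
      ([&& i < j, j < s i & s i < s j] + [&& j < i, s i < j & s j < s i]).
  rewrite big_split /= -(reindex_perm s).
  under [RHS]eq_bigr => i _ do rewrite big_split /=.
  rewrite big_split /=; congr (_ + _).
    apply: eq_bigr => i _; rewrite permK big_distrr /=.
    by apply: eq_bigr => j _; rewrite permK; lia.
  rewrite exchange_big /=; apply: eq_bigr => j _.
  by rewrite upcrossV big_distrr /=; apply: eq_bigr => i _; lia.
rewrite -big_split /=; apply: eq_bigr => i _.
by rewrite -big_split /=; apply: eq_bigr => j _; rewrite -val_eqE /=; lia.
Qed.

(** An inversion is an upper nesting, a lower nesting, or an upper arc (or loop)
    and a lower arc that overlap.  An overlapping pair is counted at the vertex
    where the first of its two arcs closes, against all arcs open there on the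
    other side.  If both close at the same peak, the pair is counted with the
    upper one, whence the correction in the second line. *)
Lemma inv_sum s :
  Defs.inv s = \sum_(v : 'I_n) (((s^-1)%g v <= v) * (uprank s v + level s v)
     + (s v < v) * (uprank s^-1 v + (level s v - ((s^-1)%g v < v)))).
Proof.
under eq_bigr => v _ do rewrite !mulnDr.
rewrite big_split !big_split /= sum_upnest sum_lownest [X in _ + (X + _)]exchange_big /=.
have -> : \sum_(v : 'I_n) ((s^-1)%g v <= v) * level s v
   = \sum_(i : 'I_n) \sum_(j : 'I_n) [&& s j < s i, s i <= j & i <= s i].
  rewrite -(reindex_perm s); apply: eq_bigr => i _.
  rewrite permK -levelV /level -(reindex_perm s) big_distrr /=.
  by apply: eq_bigr => j _; rewrite permK; lia.
have -> : \sum_(v : 'I_n) (s v < v) * (level s v - ((s^-1)%g v < v))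
   = \sum_(i : 'I_n) \sum_(j : 'I_n) [&& s j < j, i < j & j < s i].
  rewrite exchange_big /=; apply: eq_bigr => v _.
  have -> : level s v = \sum_(i : 'I_n) (i < v < s i) + ((s^-1)%g v < v).
    rewrite -(sum_pred1 ((s^-1)%g v) (fun i : 'I_n => i < v)) -big_split /=.
    apply: eq_bigr => i _; rewrite -val_eqE /=.
    by have := perm_eqV s i v; lia.
  by rewrite addnK big_distrr /=; apply: eq_bigr => i _; lia.
rewrite -!big_split /= /Defs.inv.
rewrite (card_set_pair_sum (fun i j : 'I_n => (i < j) && (s j < s i))).
apply: eq_bigr => i _; rewrite -!big_split; apply: eq_bigr => j _ /=.
have := perm_eqV s i (s j); rewrite permK; lia.
Qed.

(** A left-to-right maximum at position [i] is larger than the [i] letters before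
    it, so it is at least [i]; hence it sits on an upper arc or on a loop, and
    being a maximum means that no upper arc covers it. *)
Lemma lmax_sum s :
  lmax s = \sum_(v : 'I_n) (((s^-1)%g v <= v) && (uprank s v == 0)).
Proof.
rewrite /lmax card_set_sum -[RHS](reindex_perm s).
apply: eq_bigr => i _; rewrite permK; congr nat_of_bool; apply/forallP/andP.
  move=> is_max; split.
    rewrite -[leqLHS]sum_ltn ?(ltnW (ltn_ord i)) //.
    rewrite -[leqRHS]sum_ltn ?(ltnW (ltn_ord _)) //.
    rewrite -(reindex_perm s (fun v => (v < s i) : nat)).
    by apply: leq_sum => j _; have := is_max j; lia.
  by apply/eqP/big1 => j _; rewrite permK; have := is_max j; lia.
case=> _; rewrite sum_nat_eq0 => /forallP rank0 j.
have := rank0 j; rewrite permK => rj.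
have := perm_eqV s j (s i); rewrite permK; lia.
Qed.

Lemma rmin_lmaxV s : rmin s = lmax s^-1.
Proof.
rewrite /rmin /lmax !card_set_sum -[RHS](reindex_perm s).
apply: eq_bigr => i _; rewrite permK; congr nat_of_bool.
apply/forallP/forallP => ext j.
  have := ext ((s^-1)%g j); rewrite permKV.
  have := perm_eqV s i j; have := perm_eqV s ((s^-1)%g j) j; lia.
have := ext (s j); rewrite permK; have := perm_eqV s i (s j); rewrite permK; lia.
Qed.

(** * Exchanging cycle double ascents and descents *)

Section Weights.
Variable R : comNzRingType.
Local Open Scope ring_scope.

Fixpoint wt (w : nat -> vletter -> R) k c : R :=
  if c is l :: c' then w k l * wt w (level_after k l) c' else 1.

Lemma wt_code (w : nat -> vletter -> R) s :
  wt w 0 (code s) = \prod_(v : 'I_n) w (level s v) (letter s v).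
Proof.
rewrite -big_enum /=.
suff main d : (d <= n)%N -> wt w (level s (n - d)) (suffix s (n - d))
   = \prod_(v <- drop (n - d) (enum 'I_n)) w (level s v) (letter s v).
  by have := main n (leqnn n); rewrite subnn level0 /suffix drop0.
elim: d => [|d IH] le_dn.
  by rewrite subn0 /suffix drop_oversize ?size_enum_ord // big_nil.
have [|v def_v] := @ex_ord (n - d.+1); first lia.
have def_v1 : (n - d)%N = v.+1 by lia.
move: IH; rewrite def_v def_v1 suffix_ord => IH.
rewrite -[LHS]/(w _ _ * wt w (level_after _ _) _) level_after_letter IH; last lia.
by rewrite [in RHS](drop_nth v) ?size_enum_ord //= nth_ord_enum big_cons.
Qed.

Lemma sum_letters (f : vletter -> R) k :
  \sum_(l <- letters k) f l =
    f (None, None) + (f (Some k, None)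
    + ((\sum_(r <- iota 0 k) f (Some r, None)
        + \sum_(r <- iota 0 k) f (None, Some r))
    + \sum_(r <- iota 0 k) \sum_(r' <- iota 0 k) f (Some r, Some r'))).
Proof.
rewrite big_cons !big_cat !big_map big_allpairs_dep -[k.+1]addn1 iotaD.
by rewrite big_cat big_seq1 /=; ring.
Qed.

Definition toggle_eq (w w' : nat -> vletter -> R) : Prop :=
  [/\ forall k, w k (None, None) = w' k (None, None),
      forall k, w k (Some k, None) = w' k (Some k, None),
      forall k r r', w k (Some r, Some r') = w' k (Some r, Some r')
    & forall k r, (r < k)%N ->
        w k (Some r, None) + w k (None, Some r)
          = w' k (Some r, None) + w' k (None, Some r)].

(** Within a code, the two letters of a toggled pair lead to the same level,
    hence have the same continuations: only the sum of their weights matters. *)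
Lemma sum_codes_wt_eq (w w' : nat -> vletter -> R) m k :
  toggle_eq w w' ->
  \sum_(c <- codes m k) wt w k c = \sum_(c <- codes m k) wt w' k c.
Proof.
case=> wO wF wP wD; elim: m k => [|m IH] k; first by case: k => [|k]; rewrite ?big_seq1 ?big_nil.
rewrite codesS !big_allpairs_dep.
under eq_bigr => l _ do rewrite -mulr_sumr IH.
under [RHS]eq_bigr => l _ do rewrite -mulr_sumr.
rewrite !sum_letters /= wO wF; congr (_ + (_ + (_ + _))).
  rewrite -!mulr_suml -!mulrDl -!big_split /=; congr (_ * _).
  by rewrite !big_seq; apply: eq_bigr => r; rewrite mem_iota => lt_rk; apply: wD.
by apply: eq_bigr => r _; apply: eq_bigr => r' _; rewrite wP.
Qed.

Lemma sum_history_eq (w w' : nat -> vletter -> R) :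
  toggle_eq w w' ->
  \sum_(s : 'S_n) \prod_(v : 'I_n) w (level s v) (letter s v)
    = \sum_(s : 'S_n) \prod_(v : 'I_n) w' (level s v) (letter s v).
Proof.
move=> eq_ww'.
have sumE f : \sum_(s : 'S_n) \prod_(v : 'I_n) f (level s v) (letter s v)
   = \sum_(c <- codes n 0) wt f 0 c.
  rewrite -(perm_big _ perm_codes) /= big_map big_enum.
  by apply: eq_bigr => s _; rewrite wt_code.
by rewrite !sumE; exact: sum_codes_wt_eq.
Qed.

Section Statistics.
Variables (x y t h alpha d p q : R).

(** Cycle double ascents and descents differ only by the factor, [a] or [b].  A loop
    at level [k] makes [k] inversions with upper and [k] with lower arcs, but
    [nest] counts only the upper ones; at level 0 it is both a left-to-right
    maximum and a right-to-left minimum. *)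
Definition vertex_weight (a b : R) (k : nat) (l : vletter) : R :=
  h ^+ k *
  match l with
  | (None, None) => 1
  | (Some r, None) =>
      if r == k then t * y ^+ (k + k)%N * alpha ^+ ((k == 0) + (k == 0))%N * q ^+ k
      else a * (d * y ^+ (r + k)%N * alpha ^+ (r == 0)%N * p ^+ (k - r.+1)%N * q ^+ r)
  | (None, Some r) =>
      b * (d * y ^+ (r + k)%N * alpha ^+ (r == 0)%N * p ^+ (k - r.+1)%N * q ^+ r)
  | (Some r, Some r') =>
      x * d * y ^+ (r + k + (r' + (k - 1)))%N * alpha ^+ ((r == 0) + (r' == 0))%N
      * p ^+ (k - r.+1 + (k - r'.+1))%N * q ^+ (r + r')%N
  end.

Lemma vertex_weightE a b s v :
  vertex_weight a b (level s v) (letter s v) =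
    h ^+ level s v * x ^+ (((s^-1)%g v < v) && (s v < v))%N * a ^+ ((s^-1)%g v < v < s v)%N
    * b ^+ (s v < v < (s^-1)%g v)%N * t ^+ (s v == v)%N
    * d ^+ (((s^-1)%g v < v < s v) + (s v < v))%N
    * y ^+ (((s^-1)%g v <= v) * (uprank s v + level s v)
        + (s v < v) * (uprank s^-1 v + (level s v - ((s^-1)%g v < v))))%N
    * alpha ^+ ((((s^-1)%g v <= v) && (uprank s v == 0))
                + ((s v <= v) && (uprank s^-1 v == 0)))%N
    * p ^+ (((s^-1)%g v < v) * upcross s v + (s v < v) * upcross s^-1 v)%N
    * q ^+ (((s^-1)%g v <= v) * uprank s v + (s v < v) * uprank s^-1 v)%N.
Proof.
have up := @level_closer s v; have low := @level_closer s^-1 v.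
have fixU := @level_fix s v; have fixL := @level_fix s^-1 v.
rewrite levelV invgK in low; rewrite levelV in fixL.
rewrite /letter /vertex_weight -val_eqE /=; have eq_v := perm_eqV s v v.
case: (ltngtP (s v) v) eq_v fixU fixL up low => [lt_s|gt_s|/val_inj eq_s] eq_v;
  case: (ltngtP ((s^-1)%g v) v) eq_v => [lt_t|gt_t|/val_inj eq_t] // _ fixU fixL up low.
all: rewrite ?eqxx /= !(mul1n, mul0n, addn0, add0n, subn0, expr0, expr1, mul1r, mulr1).
- have -> : (level s v - (uprank s v).+1 = upcross s v)%N by lia.
  have -> : (level s v - (uprank s^-1 v).+1 = upcross s^-1 v)%N by lia.
  by rewrite !mulrA.
- have -> : (level s v - (uprank s^-1 v).+1 = upcross s^-1 v)%N by lia.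
  by rewrite !mulrA.
- have -> : (level s v - (uprank s v).+1 = upcross s v)%N by lia.
  by rewrite ltn_eqF ?up ?ltnS ?leq_addr // !mulrA.
- by [].
- by rewrite fixU // fixL // eqxx !mulrA.
Qed.

Lemma sum_toggle a b a' b' : a + b = a' + b' ->
  \sum_(s : 'S_n) \prod_(v : 'I_n) vertex_weight a b (level s v) (letter s v)
  = \sum_(s : 'S_n) \prod_(v : 'I_n) vertex_weight a' b' (level s v) (letter s v).
Proof.
move=> eq_ab; apply: sum_history_eq; split=> //= [k|k r lt_rk].
  by rewrite /vertex_weight eqxx.
by rewrite /vertex_weight ltn_eqF // -!mulrDr -!mulrDl eq_ab.
Qed.

Lemma prod_vertex_weight a b s :
  \prod_(v : 'I_n) vertex_weight a b (level s v) (letter s v) =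
    h ^+ depth s * x ^+ cpeak s * a ^+ cda s * b ^+ cdd s * t ^+ fixp s
    * d ^+ (cda s + Defs.drop s)%N * y ^+ Defs.inv s * alpha ^+ (lmax s + rmin s)%N
    * p ^+ (cros s - cda s)%N * q ^+ nest s.
Proof.
under eq_bigr => v _ do rewrite vertex_weightE.
rewrite !big_split /= -!expr_sum -depth_level -nest_sum -inv_sum.
rewrite cros_sum addnK rmin_lmaxV lmax_sum (lmax_sum s^-1) invgK.
by rewrite /cda /Defs.drop /cdd /cpeak /fixp !card_set_sum !big_split.
Qed.

End Statistics.

(** Both sides are sums of [vertex_weight], with loops weighted by
    [t * (1 + x)]: the left one for [a = x] and [b = 1], the right one for
    [a = 0] and [b = 1 + x].  On the right, [n - 2 * exc s] is the number of
    loops and cycle double descents when [cda s = 0]. *)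
Lemma sum_cda0 (x y t h alpha d p q : R) :
  \sum_(s : 'S_n) x ^+ exc s * (t * (1 + x)) ^+ fixp s * y ^+ Defs.inv s * h ^+ depth s
    * alpha ^+ (rmin s + lmax s)%N * d ^+ (cda s + Defs.drop s)%N
    * p ^+ (cros s - cda s)%N * q ^+ nest s
  = \sum_(s : 'S_n | cda s == 0%N)
     t ^+ fixp s * y ^+ Defs.inv s * h ^+ depth s * alpha ^+ (lmax s + rmin s)%N
     * d ^+ Defs.drop s * p ^+ cros s * q ^+ nest s
     * x ^+ exc s * (1 + x) ^+ (n - 2 * exc s)%N.
Proof.
have eq_ab : x + 1 = 0 + (1 + x) by rewrite add0r addrC.
transitivity (\sum_(s : 'S_n) \prod_(v : 'I_n)
    vertex_weight x y (t * (1 + x)) h alpha d p q x 1 (level s v) (letter s v)).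
  apply: eq_bigr => s _; rewrite prod_vertex_weight expr1n exprMn excE exprD.
  by rewrite [(rmin s + _)%N]addnC; ring.
rewrite (sum_toggle _ _ _ _ _ _ _ _ eq_ab) [RHS]big_mkcond; apply: eq_bigr => s _.
rewrite prod_vertex_weight expr0n exprMn; case: eqP => [cda0|]; last by rewrite !(mulr0, mul0r).
have -> : (n - 2 * exc s = fixp s + cdd s)%N.
  by have := exc_fix_drop s; rewrite dropE excE; lia.
by rewrite excE cda0 subn0 addn0 add0n [(1 + x) ^+ (_ + _)]exprD /=; ring.
Qed.

End Weights.
End Histories.

Local Open Scope ring_scope.

(** * The gamma expansions *)

Lemma sum_by_exc (R : comNzRingType) n (F : 'S_n -> R) (x : R) :
  \sum_(s : 'S_n | cda s == 0%N) F s * x ^+ exc s * (1 + x) ^+ (n - 2 * exc s)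
  = \sum_(0 <= k < (n %/ 2).+1)
     (\sum_(s : 'S_n | (cda s == 0)%N && (exc s == k)) F s)
       * x ^+ k * (1 + x) ^+ (n - 2 * k).
Proof.
rewrite big_mkord (partition_big (fun s => inord (exc s) : 'I_(n %/ 2).+1) xpredT) //.
apply: eq_bigr => k _; rewrite -mulrA mulr_suml; apply: eq_big => s.
  case: eqP => //= cda0; rewrite -val_eqE /= inordK //.
  by have := exc_fix_drop s; rewrite dropE excE; lia.
case/andP=> /eqP cda0 /eqP <-; rewrite inordK ?mulrA //.
by have := exc_fix_drop s; rewrite dropE excE; lia.
Qed.

Theorem theorem2p7 (R : comNzRingType) (n : nat) (x t s h alpha p q : R) :
  C1 n x t s h alpha p q
    = \sum_(0 <= k < (n %/ 2).+1)
        gamma1 n k t s h alpha p q * x ^+ k * (1 + x) ^+ (n - 2 * k)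
  /\
  C2 n x t s h alpha p q
    = \sum_(0 <= k < (n %/ 2).+1)
        gamma2 n k t s h alpha p q * x ^+ k * (1 + x) ^+ (n - 2 * k).
Proof.
split.
- rewrite -sum_by_exc /C1 /wc; have := @sum_cda0 n R x s t h alpha 1 p q.
  under eq_bigr => u _ do rewrite expr1n mulr1.
  by move=> ->; apply: eq_bigr => u _; rewrite expr1n mulr1.
- rewrite -sum_by_exc /C2 /wc; have := @sum_cda0 n R x s t h alpha p p q.
  (* with [d = p], the exponent of [p] is [cda + drop + (cros - cda)] *)
  have crosE u : @cros n u = (cda u + (cros u - cda u))%N by rewrite subnKC ?leq_cda_cros.
  under eq_bigr => u _.
    rewrite -[_ * _ * p ^+ _]mulrA -exprD.
    have -> : (cda u + Defs.drop u + (cros u - cda u) = cros u + Defs.drop u)%N.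
      by rewrite [in RHS]crosE; lia.
    over.
  by move=> ->; apply: eq_bigr => u _; rewrite [p ^+ (_ + _)]exprD; ring.
Qed.
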